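(* Let $\mathbb{X},\mathbb{Y}$ be finite-dimensional real inner product spaces, $\Omega_x\subseteq\mathbb{X}$ and $\Omega_y\subseteq\mathbb{Y}$ closed sets, and $f,g:\mathbb{X}\times\mathbb{Y}\to\mathbb{S}^n$ smooth maps. Define the multifunction $\widetilde{\mathcal{M}}:\mathbb{X}\times\mathbb{Y}\times\mathbb{S}^n\times\mathbb{S}^n\rightrightarrows\mathbb{X}\times\mathbb{Y}$ by $$\widetilde{\mathcal{M}}(u,v,\xi,\eta):=\big\{(x,y)\in\mathbb{X}\times\mathbb{Y}\ :\ u\in-x+\Omega_x,\ v\in-y+\Omega_y,\ (\xi,\eta)\in-(f(x,y),g(x,y))+\mathrm{gph}\,\mathcal{N}_{\mathbb{S}^n_+}\big\}.$$ Let $(\overline x,\overline y)\in\widetilde{\mathcal{M}}(0,0,0,0)$. Suppose that for every $0\ne w=(w_1,w_2)\in\mathcal{T}_{\Omega_x}(\overline x)\times\mathcal{T}_{\Omega_y}(\overline y)$ with $$\big(f'(\overline x,\overline y)w,\ g'(\overline x,\overline y)w\big)\in\mathcal{T}_{\mathrm{gph}\,\mathcal{N}_{\mathbb{S}^n_+}}\big(f(\overline x,\overline y),g(\overline x,\overline y)\big),$$ the following implication holds for all $(d_1,d_2,\Lambda,\Delta)\in\mathbb{X}\times\mathbb{Y}\times\mathbb{S}^n\times\mathbb{S}^n$: writing $\widetilde w:=\big(f_x'(\overline x,\overline y)w_1+f_y'(\overline x,\overline y)w_2,\ g_x'(\overline x,\overline y)w_1+g_y'(\overline x,\overline y)w_2\big)$,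 if $$d_1\in\mathcal{N}_{\Omega_x}(\overline x;w_1),\quad d_1+\nabla_xf(\overline x,\overline y)\Lambda+\nabla_xg(\overline x,\overline y)\Delta=0,$$ $$d_2\in\mathcal{N}_{\Omega_y}(\overline y;w_2),\quad d_2+\nabla_yf(\overline x,\overline y)\Lambda+\nabla_yg(\overline x,\overline y)\Delta=0,$$ $$(\Lambda,\Delta)\in\mathcal{N}_{\mathrm{gph}\,\mathcal{N}_{\mathbb{S}^n_+}}\big((f(\overline x,\overline y),g(\overline x,\overline y));\widetilde w\big),$$ then $(d_1,d_2,\Lambda,\Delta)=(0,0,0,0)$. Then the multifunction $\widetilde{\mathcal{M}}$ is calm at the origin for $(\overline x,\overline y)$.
   Context: $\mathbb{S}^n$ is the space of real symmetric $n\times n$ matrices with the Frobenius norm and trace inner product, $\mathbb{S}^n_+$ the cone of positive semidefinite matrices, $\mathcal{N}_{\mathbb{S}^n_+}$ its normal cone mapping (of convex analysis), and $\mathrm{gph}\,\mathcal{N}_{\mathbb{S}^n_+}=\{(X,Y)\in\mathbb{S}^n\times\mathbb{S}^n: X\in\mathbb{S}^n_+,\ Y\in\mathcal{N}_{\mathbb{S}^n_+}(X)\}$. $f'(\overline x,\overline y)$ is the derivative of $f$, $f'_x,f'_y$ the partial derivatives, and $\nabla_xf(\overline x,\overline y):\mathbb{S}^n\to\mathbb{X}$, $\nabla_yf(\overline x,\overline y):\mathbb{S}^n\to\mathbb{Y}$ are the adjoints of $f'_x(\overline x,\overline y)$ and $f'_y(\overline x,\overline y)$; similarly for $g$. For a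 set $S$ and $\bar z\in S$: the contingent cone is $\mathcal{T}_S(\bar z)=\{h:\exists\,t_k\downarrow0,\ h^k\to h\text{ with }\bar z+t_kh^k\in S\}$; the regular normal cone is $\widehat{\mathcal N}_S(\bar z)=\{v:\limsup_{z\to\bar z,z\in S}\frac{\langle v,z-\bar z\rangle}{\|z-\bar z\|}\le0\}$; the directional limiting normal cone in direction $u$ is $\mathcal{N}_S(\bar z;u)=\{z^*:\exists\,t_k\downarrow0,\ u^k\to u,\ z^{k*}\to z^*\text{ with }z^{k*}\in\widehat{\mathcal N}_S(\bar z+t_ku^k)\}$ (where implicitly $\bar z+t_ku^k\in S$). A multifunction $\mathcal{F}:\mathbb{Z}\rightrightarrows\mathbb{W}$ is calm at $\bar z$ for $\bar w\in\mathcal{F}(\bar z)$ if there exist $\kappa>0$, $\varepsilon>0$, $\delta>0$ such that for all $z$ with $\|z-\bar z\|\le\varepsilon$, $\mathcal{F}(z)\cap\mathbb{B}_\delta(\bar w)\subseteq\mathcal{F}(\bar z)+\kappa\|z-\bar z\|\mathbb{B}_{\mathbb{W}}$, where $\mathbb{B}_\delta(\bar w)$ is the closed ball of radius $\delta$ around $\bar w$ and $\mathbb{B}_{\mathbb{W}}$ the closed unit ball. *)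

(* Defs.v *)
From HB Require Import structures.
From mathcomp Require Import all_boot all_order all_algebra.
From mathcomp Require Import all_classical all_reals all_analysis.
From mathcomp Require Import ring lra.

Set Implicit Arguments.
Unset Strict Implicit.
Unset Printing Implicit Defensive.

Import Order.TTheory GRing.Theory Num.Theory.
Import numFieldNormedType.Exports.

Local Open Scope classical_set_scope.
Local Open Scope ring_scope.

(* The norm, hence the topology, is the one induced by the inner product;
   definiteness of [inner] follows from that of the norm. *)
HB.mixin Record NormedModule_hasInner (R : realType) V
    & NormedModule R V := {
  inner : V -> V -> R;
  innerC : forall x y, inner x y = inner y x;
  innerDl : forall x y z, inner (x + y) z = inner x z + inner y z;
  innerZl : forall (a : R) x y, inner (a *: x) y = a * inner x y;
  inner_norm : forall x, inner x x = `|x| ^+ 2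
}.

#[short(type="euclidType")]
HB.structure Definition Euclid (R : realType) :=
  {V of NormedModule R V & Vector R V & NormedModule_hasInner R V}.

HB.factory Record Vector_isEuclid (R : realType) V & Vector R V := {
  dot : V -> V -> R;
  dotC : forall x y, dot x y = dot y x;
  dotDl : forall x y z, dot (x + y) z = dot x z + dot y z;
  dotZl : forall (a : R) x y, dot (a *: x) y = a * dot x y;
  dot_ge0 : forall x, 0 <= dot x x;
  dot_eq0 : forall x, dot x x = 0 -> x = 0
}.

HB.builders Context R V & Vector_isEuclid R V.

Let nrm (x : V) : R := Num.sqrt (dot x x).

Lemma dotDr x y z : dot x (y + z) = dot x y + dot x z.
Proof. by rewrite dotC dotDl !(dotC _ x). Qed.

Lemma dotZr a x y : dot x (a *: y) = a * dot x y.
Proof. by rewrite dotC dotZl dotC. Qed.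

Lemma sqr_nrm x : nrm x ^+ 2 = dot x x.
Proof. by rewrite sqr_sqrtr ?dot_ge0. Qed.

Lemma dot_le_nrm x y : dot x y <= nrm x * nrm y.
Proof.
have [y0|y0] := eqVneq (dot y y) 0.
  rewrite (dot_eq0 y0) -(scale0r (0 : V)) dotZr mul0r.
  by rewrite mulr_ge0 ?sqrtr_ge0.
have ypos : 0 < dot y y by rewrite lt_neqAle eq_sym y0 dot_ge0.
have H := dot_ge0 (dot y y *: x + (- dot x y) *: y).
have {H} : 0 <= dot y y * (dot x x * dot y y - dot x y ^+ 2).
  move: H; rewrite !(dotDl, dotDr, dotZl, dotZr) (dotC y x) => H.
  by apply: le_trans H _; rewrite le_eqVlt; apply/orP; left; apply/eqP; ring.
rewrite pmulr_rge0// subr_ge0 => H.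
apply: le_trans (ler_norm _) _.
rewrite -(@ler_pXn2r _ 2)// ?nnegrE ?mulr_ge0 ?sqrtr_ge0//.
by rewrite exprMn !sqr_nrm real_normK ?num_real.
Qed.

Lemma nrmD x y : nrm (x + y) <= nrm x + nrm y.
Proof.
rewrite -(@ler_pXn2r _ 2)// ?nnegrE ?addr_ge0 ?sqrtr_ge0//.
rewrite sqrrD !sqr_nrm !(dotDl, dotDr) (dotC y x).
have := dot_le_nrm x y; lra.
Qed.

Lemma nrmZ (a : R) x : nrm (a *: x) = `|a| * nrm x.
Proof.
by rewrite /nrm dotZl dotZr mulrA -expr2 sqrtrM ?sqr_ge0// sqrtr_sqr.
Qed.

Lemma nrm_eq0 x : nrm x = 0 -> x = 0.
Proof. by move=> x0; apply: dot_eq0; rewrite -sqr_nrm x0 expr0n. Qed.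

HB.instance Definition _ := Lmodule_isNormed.Build R V nrmD nrmZ nrm_eq0.

Lemma dot_norm (x : V) : dot x x = `|x| ^+ 2.
Proof. by rewrite -sqr_nrm. Qed.

HB.instance Definition _ :=
  NormedModule_hasInner.Build R V dotC dotDl dotZl dot_norm.

HB.end.

(* [X * Y] carries the max-norm in the library, which is not induced by an
   inner product; [eprod X Y] is the same space with the inner product
   <(x, y), (x', y')> = <x, x'> + <y, y'>. *)
Definition eprod (R : realType) (X Y : euclidType R) : Type := (X * Y)%type.

HB.instance Definition _ (R : realType) (X Y : euclidType R) :=
  Vector.copy (eprod X Y) (X * Y)%type.

Definition eprod_dot (R : realType) (X Y : euclidType R) (z w : eprod X Y) : R :=
  inner z.1 w.1 + inner z.2 w.2.

Fact eprod_dotC (R : realType) (X Y : euclidType R) (z w : eprod X Y) :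
  eprod_dot z w = eprod_dot w z.
Proof. by rewrite /eprod_dot innerC [inner z.2 _]innerC. Qed.

Fact eprod_dotDl (R : realType) (X Y : euclidType R) (z z' w : eprod X Y) :
  eprod_dot (z + z') w = eprod_dot z w + eprod_dot z' w.
Proof. by rewrite /eprod_dot !innerDl addrACA. Qed.

Fact eprod_dotZl (R : realType) (X Y : euclidType R) (a : R) (z w : eprod X Y) :
  eprod_dot (a *: z) w = a * eprod_dot z w.
Proof. by rewrite /eprod_dot !innerZl mulrDr. Qed.

Fact eprod_dot_ge0 (R : realType) (X Y : euclidType R) (z : eprod X Y) :
  0 <= eprod_dot z z.
Proof. by rewrite /eprod_dot !inner_norm addr_ge0 ?sqr_ge0. Qed.

Fact eprod_dot_eq0 (R : realType) (X Y : euclidType R) (z : eprod X Y) :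
  eprod_dot z z = 0 -> z = 0.
Proof.
case: z => x y; rewrite /eprod_dot !inner_norm => /eqP.
rewrite paddr_eq0 ?sqr_ge0// !sqrf_eq0 !normr_eq0.
by move=> /andP[/eqP/= -> /eqP/= ->].
Qed.

HB.instance Definition _ (R : realType) (X Y : euclidType R) :=
  Vector_isEuclid.Build R (eprod X Y) (@eprod_dotC R X Y) (@eprod_dotDl R X Y)
    (@eprod_dotZl R X Y) (@eprod_dot_ge0 R X Y) (@eprod_dot_eq0 R X Y).

Definition symmx (R : realType) n : {pred 'M[R]_n} := fun A => A^T == A.
Arguments symmx : clear implicits.

Fact symmx_submod_closed (R : realType) n : submod_closed (symmx R n).
Proof.
split=> [|a A B]; rewrite ?unfold_in /= ?trmx0// => /eqP sA /eqP sB.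
by rewrite linearP/= sA sB.
Qed.

HB.instance Definition _ (R : realType) n :=
  GRing.isSubmodClosed.Build R 'M[R]_n (symmx R n) (@symmx_submod_closed R n).

Record Sym (R : realType) n := MkSym {
  symval :> 'M[R]_n;
  symvalP : symval \in symmx R n
}.

HB.instance Definition _ (R : realType) n := [isSub for @symval R n].
HB.instance Definition _ (R : realType) n := [Choice of Sym R n by <:].
HB.instance Definition _ (R : realType) n :=
  [SubChoice_isSubZmodule of Sym R n by <:].
HB.instance Definition _ (R : realType) n :=
  [SubZmodule_isSubLmodule of Sym R n by <:].

Definition antisym_part (R : realType) n (A : 'M[R]_n) : 'M[R]_n := A^T - A.

Fact antisym_part_linear (R : realType) n : linear (@antisym_part R n).
Proof.
by move=> a A B; rewrite /antisym_part linearP/= opprD addrACA scalerBr.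
Qed.

HB.instance Definition _ (R : realType) n :=
  GRing.isLinear.Build R 'M[R]_n 'M[R]_n *:%R (@antisym_part R n)
    (@antisym_part_linear R n).

Definition symspace (R : realType) n : {vspace 'M[R]_n} :=
  lker (linfun (@antisym_part R n)).

Fact mem_symspace (R : realType) n (A : 'M[R]_n) :
  (A \in symspace R n) = (A \in symmx R n).
Proof. by rewrite memv_ker lfunE/= subr_eq0 unfold_in. Qed.

Import VectorInternalTheory.

Fact Sym_vect_axiom (R : realType) n : Vector.axiom (\dim (symspace R n)) (Sym R n).
Proof.
pose toU (A : Sym R n) : subvs_of (symspace R n) := vsproj _ (val A).
have toUK (A : Sym R n) : vsval (toU A) = val A.
  by rewrite vsprojK// mem_symspace; exact: symvalP.
have ofP (u : subvs_of (symspace R n)) : vsval u \in symmx R n.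
  by rewrite -mem_symspace subvsP.
pose ofU u : Sym R n := MkSym (ofP u).
exists (fun A => v2r (toU A)).
  move=> a A B; suff -> : toU (a *: A + B) = a *: toU A + toU B.
    by rewrite linearP.
  by apply: val_inj; rewrite [RHS]linearP/= !toUK linearP.
exists (fun r => ofU (r2v r)) => [A|r].
  by rewrite v2rK; apply: val_inj; exact: toUK.
by rewrite /toU/= vsvalK r2vK.
Qed.

HB.instance Definition _ (R : realType) n :=
  Lmodule_hasFinDim.Build R (Sym R n) (@Sym_vect_axiom R n).

Definition frobenius (R : realType) n (A B : Sym R n) : R :=
  \tr ((symval A)^T *m symval B).

Fact frobeniusC (R : realType) n (A B : Sym R n) :
  frobenius A B = frobenius B A.
Proof. by rewrite /frobenius -mxtrace_tr trmx_mul trmxK. Qed.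

Fact frobeniusDl (R : realType) n (A B C : Sym R n) :
  frobenius (A + B) C = frobenius A C + frobenius B C.
Proof. by rewrite /frobenius !raddfD/= mulmxDl raddfD. Qed.

Fact frobeniusZl (R : realType) n (a : R) (A B : Sym R n) :
  frobenius (a *: A) B = a * frobenius A B.
Proof. by rewrite /frobenius !linearZ/= -scalemxAl linearZ. Qed.

Fact frobeniusE (R : realType) n (A : Sym R n) :
  frobenius A A = \sum_(i < n) \sum_(j < n) symval A j i ^+ 2.
Proof.
apply: eq_bigr => i _; rewrite mxE; apply: eq_bigr => j _.
by rewrite mxE expr2.
Qed.

Fact frobenius_ge0 (R : realType) n (A : Sym R n) : 0 <= frobenius A A.
Proof.
by rewrite frobeniusE; do 2!apply: sumr_ge0 => ? _; exact: sqr_ge0.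
Qed.

Fact frobenius_eq0 (R : realType) n (A : Sym R n) : frobenius A A = 0 -> A = 0.
Proof.
rewrite frobeniusE => /psumr_eq0P A0.
apply/val_inj/matrixP => i j /=; rewrite mxE; apply/eqP; rewrite -sqrf_eq0.
have sq_ge0 k l : 0 <= symval A k l ^+ 2 by exact: sqr_ge0.
have /psumr_eq0P -> // := A0 (fun k _ => sumr_ge0 _ (fun l _ => sq_ge0 l k)) j isT.
Qed.

HB.instance Definition _ (R : realType) n :=
  Vector_isEuclid.Build R (Sym R n) (@frobeniusC R n) (@frobeniusDl R n)
    (@frobeniusZl R n) (@frobenius_ge0 R n) (@frobenius_eq0 R n).

Definition psd (R : realType) n : set (Sym R n) :=
  [set A | forall x : 'cV[R]_n, 0 <= (x^T *m symval A *m x) 0 0].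
Arguments psd : clear implicits.

(* Continuity of the derivative is with respect to the operator norm. *)
Definition continuously_differentiable (R : realType) (V W : euclidType R)
    (f : V -> W) :=
  (forall z, differentiable f z) /\
  (forall z (e : R), 0 < e ->
    \forall z' \near z, forall h, `|'d f z' h - 'd f z h| <= e * `|h|).

(* The vector representing h |-> <v, L h>; [xget] picks the unique element of
   a set that is a singleton when [L] is linear, see [adjointP]. *)
Definition adjoint (R : realType) (V W : euclidType R) (L : V -> W) (v : W) : V :=
  xget 0 [set u | forall h, inner u h = inner v (L h)].

Lemma inner_inj (R : realType) (V : euclidType R) (u v : V) :
  (forall h, inner u h = inner v h) -> u = v.
Proof.
move=> uv; apply/eqP; rewrite -subr_eq0 -normr_eq0 -sqrf_eq0 -inner_norm.
by rewrite innerDl -scaleN1r innerZl uv mulN1r subrr.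
Qed.

Lemma innerDr (R : realType) (V : euclidType R) (x y z : V) :
  inner x (y + z) = inner x y + inner x z.
Proof. by rewrite innerC innerDl !(innerC x). Qed.

Lemma innerZr (R : realType) (V : euclidType R) (a : R) (x y : V) :
  inner x (a *: y) = a * inner x y.
Proof. by rewrite innerC innerZl innerC. Qed.

Lemma inner_sumr (R : realType) (V : euclidType R) (u : V) n
    (a : 'I_n -> R) (b : 'I_n -> V) :
  inner u (\sum_i a i *: b i) = \sum_i a i * inner u (b i).
Proof.
elim/big_rec2: _ => [|i y1 y2 _ <-]; last by rewrite innerDr innerZr.
by rewrite -(scale0r (0 : V)) innerZr mul0r.
Qed.

Lemma riesz (R : realType) (V : euclidType R) (phi : {scalar V}) :
  exists u : V, forall h, inner u h = phi h.
Proof.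
pose b := vbasis {:V}.
have bE (h : V) : h = \sum_i coord b i h *: b`_i.
  by apply: coord_vbasis; exact: memvf.
pose G (u : V) : 'rV[R]_(\dim {:V}) := \row_i inner u b`_i.
have Glin : linear G.
  by move=> a u v; apply/rowP => i; rewrite !mxE innerDl innerZl.
pose GL := GRing.isLinear.Build _ _ _ _ G Glin.
pose Gl : {linear V -> 'rV[R]_(\dim {:V})} := HB.pack G GL.
have kerG : lker (linfun Gl) == 0%VS.
  apply/lker0P => u v; rewrite !lfunE/= => /rowP uv.
  apply: inner_inj => h; rewrite (bE h) !inner_sumr.
  by apply: eq_bigr => i _; have := uv i; rewrite !mxE => ->.
have imG : limg (linfun Gl) = fullv.
  apply/eqP; rewrite eqEdim subvf/= limg_dim_eq.
    by rewrite dimvf /dim/= mul1n.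
  by move/eqP: kerG => ->; rewrite capv0.
have /memv_imgP[u _ uE] : \row_i phi b`_i \in limg (linfun Gl).
  by rewrite imG memvf.
exists u => h; rewrite {1 2}(bE h) inner_sumr linear_sum/=.
apply: eq_bigr => i _; rewrite linearZ/=; congr (_ * _).
by move/rowP : uE => /(_ i); rewrite lfunE/= !mxE => <-.
Qed.

Lemma adjointP (R : realType) (V W : euclidType R) (L : {linear V -> W}) (v : W)
    (h : V) :
  inner (adjoint L v) h = inner v (L h).
Proof.
have phi_lin : scalar (fun h => inner v (L h)).
  by move=> a x y; rewrite linearP innerDr innerZr.
pose PL := GRing.isLinear.Build _ _ _ _ (fun h => inner v (L h)) phi_lin.
pose phi : {scalar V} := HB.pack (fun h => inner v (L h)) PL.
have [u uE] := riesz phi.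
rewrite /adjoint; case: xgetP => [w _ -> //|/(_ u) []].
exact: uE.
Qed.

Definition partial1 (R : realType) (X Y W : euclidType R)
    (f : eprod X Y -> W) (x : X) (y : Y) : {linear X -> W} :=
  'd (fun x' : X => f (x', y)) x.

Definition partial2 (R : realType) (X Y W : euclidType R)
    (f : eprod X Y -> W) (x : X) (y : Y) : {linear Y -> W} :=
  'd (fun y' : Y => f (x, y')) y.

Definition gradient1 (R : realType) (X Y W : euclidType R)
    (f : eprod X Y -> W) (x : X) (y : Y) : W -> X :=
  adjoint (partial1 f x y).

Definition gradient2 (R : realType) (X Y W : euclidType R)
    (f : eprod X Y -> W) (x : X) (y : Y) : W -> Y :=
  adjoint (partial2 f x y).

Definition convex_normal_cone (R : realType) (V : euclidType R) (C : set V)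
    (x : V) : set V :=
  [set v | C x /\ forall z, C z -> inner v (z - x) <= 0].

Definition gph (R : realType) (V W : euclidType R) (F : V -> set W) :
    set (eprod V W) :=
  [set z | F z.1 z.2].

Definition contingent_cone (R : realType) (V : euclidType R) (S : set V)
    (z : V) : set V :=
  [set h | exists (t : R^nat) (h_ : V^nat),
    [/\ forall k, 0 < t k, t @ \oo --> (0 : R), h_ @ \oo --> h
      & forall k, S (z + t k *: h_ k)]].

(* The limsup is over z' -> z with z' in S and z' <> z; it is -oo when z is
   isolated in S. *)
Definition regular_normal_cone (R : realType) (V : euclidType R) (S : set V)
    (z : V) : set V :=
  [set v | S z /\
    (limf_esup (fun z' => (inner v (z' - z) / `|z' - z|)%:E)
       (within S z^') <= 0)%E].

Definition limiting_normal_cone_dir (R : realType) (V : euclidType R)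
    (S : set V) (z u : V) : set V :=
  [set v | exists (t : R^nat) (u_ v_ : V^nat),
    [/\ forall k, 0 < t k, t @ \oo --> (0 : R), u_ @ \oo --> u, v_ @ \oo --> v
      & forall k, regular_normal_cone S (z + t k *: u_ k) (v_ k)]].

Definition calm (R : realType) (Z W : euclidType R) (F : Z -> set W)
    (z : Z) (w : W) : Prop :=
  exists kappa eps delta : R, [/\ 0 < kappa, 0 < eps, 0 < delta &
    forall z', `|z' - z| <= eps ->
      F z' `&` closed_ball_ Num.norm w delta `<=`
      [set a + (kappa * `|z' - z|) *: b |
         a in F z & b in closed_ball_ Num.norm (0 : W) 1]].

Definition gphN_psd (R : realType) n : set (eprod (Sym R n) (Sym R n)) :=
  gph (convex_normal_cone (psd R n)).
Arguments gphN_psd : clear implicits.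

(* A parameter is encoded as (((u, v), xi), eta); membership of u in the
   translate - x + Omega_x is written Omega_x (x + u), and likewise for v and
   (xi, eta). *)
Definition Mtilde (R : realType) n (X Y : euclidType R)
    (Omega_x : set X) (Omega_y : set Y) (f g : eprod X Y -> Sym R n)
    (p : eprod (eprod (eprod X Y) (Sym R n)) (Sym R n)) : set (eprod X Y) :=
  let: (u, v, xi, eta) := p in
  [set z : eprod X Y |
    [/\ Omega_x (z.1 + u), Omega_y (z.2 + v)
      & gphN_psd R n (f z + xi, g z + eta)]].

(* Main.v *)
From HB Require Import structures.
Require Import Defs.
From mathcomp Require Import all_boot all_order all_algebra.
From mathcomp Require Import all_classical all_reals all_analysis.
From mathcomp Require Import ring lra.

Set Implicit Arguments.
Unset Strict Implicit.
Unset Printing Implicit Defensive.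

Import Order.TTheory GRing.Theory Num.Theory.
Import numFieldNormedType.Exports.

Local Open Scope classical_set_scope.
Local Open Scope ring_scope.

(** The system is [G z + p \in D] with [G z = (z, (f z, g z))] and [D] the
    product of [Omega_x], [Omega_y] and the graph of the normal cone mapping.
    Calmness at [zb] says that the distance from [z] to the solutions of
    [G z \in D] is at most [kappa * |p|] whenever [G z + p \in D], for [z]
    near [zb] and [p] near [0].

    If calmness fails, then for every [e > 0] there is a feasible pair
    [(z0, p0)] near [(zb, 0)] with [z0] further than [2 / e * |p0|] from all
    solutions ([not_calm_normals]). Minimize [|p| + e * |z - z0|] over the
    feasible pairs; closed bounded sets are compact, so a minimizer [(z, p)]
    exists ([penalized_minimizer]). Its first component has moved less than
    the distance to the solutions, so [p] is not zero, and [|p|] is small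
    relative to [|z - zb|]. Optimality ([penalized_minimizer_normal]) makes
    the unit vector [v = - p / |p|] a regular normal to [D] at [G z + p], since
    [G z + p] is a nearest point of [D] to [G z]; and it bounds
    [G'(z)^* v] by [e], since [|G z + p - G z'|] can fall below [|p|] by
    at most [e * |z' - z|].

    As [e] tends to [0], the directions [(z - zb) / |z - zb|] and the normals
    [v] have unit limit points [w] and [vb], by compactness. Because [|p|] is
    negligible against [|z - zb|], the points [G z + p] approach [G zb] in the
    direction [G'(zb) w], so [vb] is a limiting normal to [D] in that
    direction, and [G'(zb)^* vb = 0] ([calm_of_directional_normals]). The
    components of [vb] are directional limiting normals to the factors of [D]
    ([limiting_normal_dir_prod]), and [G'(zb)^* vb = 0] is the pair of
    multiplier equations. The hypothesis gives [vb = 0], contradicting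
    [|vb| = 1]. *)

(** * Euclidean spaces *)

Section InnerProduct.
Context (R : realType) (V : euclidType R).
Implicit Types x y z : V.

Lemma inner0l x : inner 0 x = 0.
Proof. by rewrite -(scale0r (0 : V)) innerZl mul0r. Qed.

Lemma inner0r x : inner x 0 = 0.
Proof. by rewrite innerC inner0l. Qed.

Lemma innerNl x y : inner (- x) y = - inner x y.
Proof. by rewrite -scaleN1r innerZl mulN1r. Qed.

Lemma innerNr x y : inner x (- y) = - inner x y.
Proof. by rewrite innerC innerNl innerC. Qed.

Lemma innerBl x y z : inner (x - y) z = inner x z - inner y z.
Proof. by rewrite innerDl innerNl. Qed.

Lemma innerBr x y z : inner x (y - z) = inner x y - inner x z.
Proof. by rewrite innerDr innerNr. Qed.

Lemma sqr_normD x y : `|x + y| ^+ 2 = `|x| ^+ 2 + 2 * inner x y + `|y| ^+ 2.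
Proof.
rewrite -!inner_norm innerDl !innerDr (innerC y x); ring.
Qed.

Lemma inner_le_norm x y : inner x y <= `|x| * `|y|.
Proof.
have [->|x0] := eqVneq x 0; first by rewrite inner0l normr0 mul0r.
have [->|y0] := eqVneq y 0; first by rewrite inner0r normr0 mulr0.
have xy : 0 < `|x| * `|y| by rewrite mulr_gt0 ?normr_gt0.
have : 0 <= `| `|y| *: x + (- `|x|) *: y| ^+ 2 by exact: sqr_ge0.
rewrite sqr_normD innerZl innerZr !normrZ normrN !normr_id => H.
rewrite -(ler_pM2l xy); lra.
Qed.

Lemma norm_inner_le x y : `|inner x y| <= `|x| * `|y|.
Proof.
rewrite ler_norml inner_le_norm andbT lerNl -innerNl.
by rewrite -(normrN x) inner_le_norm.
Qed.

End InnerProduct.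

Section EuclideanProduct.
Context (R : realType) (X Y : euclidType R).
Implicit Types z w : eprod X Y.

Lemma inner_eprod z w : inner z w = inner z.1 w.1 + inner z.2 w.2.
Proof. by []. Qed.

Lemma sqr_norm_eprod z : `|z| ^+ 2 = `|z.1| ^+ 2 + `|z.2| ^+ 2.
Proof. by rewrite -!inner_norm. Qed.

Lemma norm_fst_le z : `|z.1| <= `|z|.
Proof.
rewrite -(@ler_pXn2r _ 2)// ?nnegrE// sqr_norm_eprod.
by rewrite lerDl sqr_ge0.
Qed.

Lemma norm_snd_le z : `|z.2| <= `|z|.
Proof.
rewrite -(@ler_pXn2r _ 2)// ?nnegrE// sqr_norm_eprod.
by rewrite lerDr sqr_ge0.
Qed.

Lemma norm_eprod_le z : `|z| <= `|z.1| + `|z.2|.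
Proof.
rewrite -(@ler_pXn2r _ 2)// ?nnegrE ?addr_ge0// sqr_norm_eprod sqrrD.
rewrite -addrA lerD2l lerDr mulrn_wge0// mulr_ge0//.
Qed.

Lemma norm_eprod_fst (x : X) : `|(x, 0) : eprod X Y| = `|x|.
Proof.
by apply/eqP; rewrite -(@eqrXn2 _ 2)// sqr_norm_eprod/= normr0 expr0n addr0.
Qed.

Lemma norm_eprod_snd (y : Y) : `|(0, y) : eprod X Y| = `|y|.
Proof.
by apply/eqP; rewrite -(@eqrXn2 _ 2)// sqr_norm_eprod/= normr0 expr0n add0r.
Qed.

End EuclideanProduct.

Lemma nonexpansive_continuous (R : realType) (V W : normedModType R)
    (f : V -> W) :
  (forall x y, `|f x - f y| <= `|x - y|) -> continuous f.
Proof.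
move=> f1 x; apply/cvgrPdist_le => e e0.
near=> y; apply: le_trans (f1 _ _) _.
by near: y; apply: cvgr_dist_le.
Unshelve. all: by end_near. Qed.

Lemma fst_eprod_continuous (R : realType) (X Y : euclidType R) :
  continuous (fun z : eprod X Y => z.1).
Proof. by apply: (@nonexpansive_continuous _ (eprod X Y)) => z w; exact: (norm_fst_le (z - w)). Qed.

Lemma snd_eprod_continuous (R : realType) (X Y : euclidType R) :
  continuous (fun z : eprod X Y => z.2).
Proof. by apply: (@nonexpansive_continuous _ (eprod X Y)) => z w; exact: (norm_snd_le (z - w)). Qed.

(** Coordinates in a basis are inner products with fixed vectors, so they are
    bounded on a bounded set, which therefore lies in the image of a box of
    the coordinate space under a continuous map. *)
Lemma euclid_bounded_closed_compact (R : realType) (V : euclidType R)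
    (A : set V) (M : R) :
  closed A -> (forall x, A x -> `|x| <= M) -> compact A.
Proof.
move=> Acl AM.
pose b := vbasis {:V}; pose n := \dim {:V}.
pose L (r : 'rV[R]_n) : V := \sum_i r ord0 i *: b`_i.
have /choice[u uE] : forall i : 'I_n, exists u : V, forall h,
    inner u h = coord b i h by move=> i; exact: riesz.
have Lc : continuous L.
  apply: (@continuous_big _ _ +%R) => [|i _ r]; first exact: add_continuous.
  by apply: (@cvgZr_tmp _ _ _ (nbhs r)); exact: (@coord_continuous _ _ _ ord0 i r).
pose K : set 'rV[R]_n := [set r | forall i,
  `[- (`|u i| * M), `|u i| * M]%classic (r ord0 i)].
have Kc : compact K.
  by apply: (rV_compact (A := fun i => `[- (`|u i| * M), `|u i| * M]%classic))
    => i; exact: segment_compact.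
apply: (@subclosed_compact _ A (L @` K)) => //.
  by apply: continuous_compact => //; exact: continuous_subspaceT.
move=> x Ax; exists (\row_i coord b i x).
  move=> i /=; rewrite mxE in_itv/= -ler_norml -uE.
  by apply: le_trans (norm_inner_le _ _) _; rewrite ler_wpM2l// AM.
rewrite /L; under eq_bigr do rewrite mxE.
by apply/esym; apply: coord_vbasis; exact: memvf.
Qed.

(** * Derivatives *)

Section Differentiation.
Context (R : realType).

Lemma diff_remainder (V W : normedModType R) (f : V -> W) z (e : R) :
  differentiable f z -> 0 < e ->
  \forall h \near 0, `|f (z + h) - f z - 'd f z h| <= e * `|h|.
Proof.
move=> /diff_locally/eqaddoP H /H; apply: filterS => h /=.
by rewrite fctE/= !fctE opprD addrA (addrC h).
Qed.

Lemma diff_remainder_unique (V W : normedModType R) (f : V -> W) z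
    (L : {linear V -> W}) :
  continuous L ->
  (forall e : R, 0 < e ->
    \forall h \near 0, `|f (z + h) - f z - L h| <= e * `|h|) ->
  differentiable f z /\ 'd f z = L :> (V -> W).
Proof.
move=> Lc H.
have fE : f \o shift z = cst (f z) + L +o_ 0 id.
  apply/eqaddoP => e /H; apply: filterS => h /=.
  by rewrite fctE/= !fctE opprD addrA (addrC h).
have dE := diff_unique Lc fE.
by split=> //; apply/diff_locallyP; rewrite dE.
Qed.

Context (V W1 W2 : euclidType R).

Definition pair_eprod (f : V -> W1) (g : V -> W2) (z : V) : eprod W1 W2 :=
  (f z, g z).

(** [eprod] carries the Euclidean norm, not the max norm of pairs, so limits
    and derivatives of pairs are obtained from [norm_eprod_le]. *)
Lemma cvg_eprod (T : Type) (F : set_system T) (FF : Filter F)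
    (f : T -> W1) (g : T -> W2) (a : W1) (b : W2) :
  f @ F --> a -> g @ F --> b ->
  (fun z => (f z, g z) : eprod W1 W2) @ F --> ((a, b) : eprod W1 W2).
Proof.
move=> fc gc; apply/cvgrPdist_le => e e0; near=> z.
apply: le_trans (norm_eprod_le _) _.
rewrite (splitr e) lerD//=.
  by near: z; apply: cvgr_dist_le => //; rewrite divr_gt0.
by near: z; apply: cvgr_dist_le => //; rewrite divr_gt0.
Unshelve. all: by end_near. Qed.

Lemma pair_linear (f : {linear V -> W1}) (g : {linear V -> W2}) :
  linear (pair_eprod f g).
Proof. by move=> a x y; rewrite /pair_eprod !linearP. Qed.

Lemma diff_eprod (f : V -> W1) (g : V -> W2) z :
  differentiable f z -> differentiable g z ->
  differentiable (pair_eprod f g) z /\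
  'd (pair_eprod f g) z = pair_eprod ('d f z) ('d g z) :> (V -> _).
Proof.
move=> df dg.
pose LL := GRing.isLinear.Build _ _ _ _ _ (pair_linear ('d f z) ('d g z)).
pose L : {linear V -> eprod W1 W2} := HB.pack (pair_eprod ('d f z) ('d g z)) LL.
apply: (@diff_remainder_unique _ _ _ _ L).
  by move=> x; apply: cvg_eprod; exact: diff_continuous.
move=> e e0; near=> h.
apply: le_trans (norm_eprod_le _) _.
rewrite (splitr e) mulrDl lerD//=.
  by near: h; apply: diff_remainder => //; rewrite divr_gt0.
by near: h; apply: diff_remainder => //; rewrite divr_gt0.
Unshelve. all: by end_near. Qed.

Lemma continuously_differentiable_pair (f : V -> W1) (g : V -> W2) :
  continuously_differentiable f -> continuously_differentiable g ->
  continuously_differentiable (pair_eprod f g).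
Proof.
move=> [df cf] [dg cg]; split=> [z|z e e0].
  by have [] := diff_eprod (df z) (dg z).
near=> z' => h.
rewrite (diff_eprod (df z') (dg z')).2 (diff_eprod (df z) (dg z)).2.
apply: le_trans (norm_eprod_le _) _.
rewrite (splitr e) mulrDl lerD//=; move: h; near: z'.
  by apply: cf; rewrite divr_gt0.
by apply: cg; rewrite divr_gt0.
Unshelve. all: by end_near. Qed.

End Differentiation.

Lemma continuously_differentiable_id (R : realType) (V : euclidType R) :
  continuously_differentiable (idfun : V -> V).
Proof.
split=> [z|z e e0]; first exact: ex_diff.
near=> z' => h; rewrite !diff_val subrr normr0 mulr_ge0//; exact: ltW.
Unshelve. all: by end_near. Qed.

Section PartialDerivatives.
Context (R : realType) (X Y W : euclidType R) (f : eprod X Y -> W).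

Let inl_linear : linear (fun x : X => (x, 0) : eprod X Y).
Proof. by move=> a x x'; congr pair; rewrite /= scaler0 addr0. Qed.

Let inr_linear : linear (fun y : Y => (0, y) : eprod X Y).
Proof. by move=> a y y'; congr pair; rewrite /= scaler0 addr0. Qed.

Lemma partial1E x y h : differentiable f ((x, y) : eprod X Y) ->
  partial1 f x y h = 'd f ((x, y) : eprod X Y) ((h, 0) : eprod X Y).
Proof.
move=> df.
pose LL := GRing.isLinear.Build _ _ _ _ _ inl_linear.
pose L : {linear X -> eprod X Y} := HB.pack (fun x : X => (x, 0) : eprod X Y) LL.
have [di dE] : differentiable (fun x' => (x', y) : eprod X Y) x /\
    'd (fun x' => (x', y) : eprod X Y) x = L :> (X -> eprod X Y).
  apply: (@diff_remainder_unique _ _ _ _ _ L) => [x'|e e0].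
    by apply: cvg_eprod; [exact: cvg_id|exact: cvg_cst].
  near=> k; rewrite [X in `|X|](_ : _ = 0); last first.
    by congr pair => /=; [rewrite addrAC addrK subrr|rewrite subrr subr0].
  by rewrite normr0 mulr_ge0// ltW.
by rewrite /partial1 (diff_comp (g := f) di df)/= dE.
Unshelve. all: by end_near. Qed.

Lemma partial2E x y h : differentiable f ((x, y) : eprod X Y) ->
  partial2 f x y h = 'd f ((x, y) : eprod X Y) ((0, h) : eprod X Y).
Proof.
move=> df.
pose LL := GRing.isLinear.Build _ _ _ _ _ inr_linear.
pose L : {linear Y -> eprod X Y} := HB.pack (fun y : Y => (0, y) : eprod X Y) LL.
have [di dE] : differentiable (fun y' => (x, y') : eprod X Y) y /\
    'd (fun y' => (x, y') : eprod X Y) y = L :> (Y -> eprod X Y).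
  apply: (@diff_remainder_unique _ _ _ _ _ L) => [x'|e e0].
    by apply: cvg_eprod; [exact: cvg_cst|exact: cvg_id].
  near=> k; rewrite [X in `|X|](_ : _ = 0); last first.
    by congr pair => /=; [rewrite subrr subr0|rewrite addrAC addrK subrr].
  by rewrite normr0 mulr_ge0// ltW.
by rewrite /partial2 (diff_comp (g := f) di df)/= dE.
Unshelve. all: by end_near. Qed.

Lemma partialsE x y (w : eprod X Y) : differentiable f ((x, y) : eprod X Y) ->
  partial1 f x y w.1 + partial2 f x y w.2 = 'd f ((x, y) : eprod X Y) w.
Proof.
move=> df; rewrite partial1E// partial2E// -linearD; congr ('d f _ _).
by case: w => w1 w2; congr pair; rewrite /= ?addr0 ?add0r.
Qed.

Lemma inner_gradient1 x y v h : differentiable f ((x, y) : eprod X Y) ->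
  inner (gradient1 f x y v) h =
  inner v ('d f ((x, y) : eprod X Y) ((h, 0) : eprod X Y)).
Proof. by move=> df; rewrite -partial1E//; exact: adjointP. Qed.

Lemma inner_gradient2 x y v h : differentiable f ((x, y) : eprod X Y) ->
  inner (gradient2 f x y v) h =
  inner v ('d f ((x, y) : eprod X Y) ((0, h) : eprod X Y)).
Proof. by move=> df; rewrite -partial2E//; exact: adjointP. Qed.

End PartialDerivatives.

Section Stationarity.
Context (R : realType) (X Y W1 W2 : euclidType R).
Context (f : eprod X Y -> W1) (g : eprod X Y -> W2) (x : X) (y : Y)
  (df : differentiable f ((x, y) : eprod X Y))
  (dg : differentiable g ((x, y) : eprod X Y)).

Lemma gradient1_stationary (d : X) (v1 : W1) (v2 : W2) :
  (forall h : X, inner d h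
    + inner v1 ('d f ((x, y) : eprod X Y) ((h, 0) : eprod X Y))
    + inner v2 ('d g ((x, y) : eprod X Y) ((h, 0) : eprod X Y)) = 0) ->
  d + gradient1 f x y v1 + gradient1 g x y v2 = 0.
Proof.
move=> H; apply: inner_inj => h; rewrite inner0l !innerDl.
by apply: etrans (H h); congr (_ + _ + _); exact: inner_gradient1.
Qed.

Lemma gradient2_stationary (d : Y) (v1 : W1) (v2 : W2) :
  (forall h : Y, inner d h
    + inner v1 ('d f ((x, y) : eprod X Y) ((0, h) : eprod X Y))
    + inner v2 ('d g ((x, y) : eprod X Y) ((0, h) : eprod X Y)) = 0) ->
  d + gradient2 f x y v1 + gradient2 g x y v2 = 0.
Proof.
move=> H; apply: inner_inj => h; rewrite inner0l !innerDl.
by apply: etrans (H h); congr (_ + _ + _); exact: inner_gradient2.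
Qed.

End Stationarity.

(** * Normal cones *)

Section NormalCones.
Context (R : realType).

(** When [z] is isolated in [S] the limsup is [-oo], and near [z] the condition
    on the right concerns [z' = z] only, where both sides are [0]. *)
Lemma regular_normalP (V : euclidType R) (S : set V) (z v : V) :
  regular_normal_cone S z v <->
  S z /\ forall e : R, 0 < e ->
    \forall z' \near z, S z' -> inner v (z' - z) <= e * `|z' - z|.
Proof.
split=> [[Sz H]|[Sz H]]; split => //.
  move=> e e0.
  have /ereal_inf_lt[_ [A /= FA <-] Ae] :
      (limf_esup (fun z' => (inner v (z' - z) / `|z' - z|)%:E)
        (within S z^') < e%:E)%E by apply: le_lt_trans H _; rewrite lte_fin.
  have {FA} : \forall z' \near z, z' != z -> S z' -> A z' by exact: FA.
  apply: filterS => z' Az' Sz'.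
  have [->|z'z] := eqVneq z' z; first by rewrite subrr inner0r normr0 mulr0.
  rewrite -ler_pdivrMr ?normr_gt0 ?subr_eq0// -lee_fin.
  apply: le_trans (ltW Ae); apply: ereal_sup_ubound; exists z' => //.
  exact: Az'.
apply/lee_addgt0Pr => e e0; rewrite add0e.
pose A := [set z' | inner v (z' - z) / `|z' - z| <= e].
apply: (@le_trans _ _ (ereal_sup ((fun z' =>
    (inner v (z' - z) / `|z' - z|)%:E) @` A))).
  apply: ereal_inf_lbound; exists A => //.
  suff : \forall z' \near z, z' != z -> S z' -> A z' by [].
  apply: filterS (H _ e0) => z' He z'z Sz'.
  by rewrite /A/= ler_pdivrMr ?normr_gt0 ?subr_eq0//; exact: He.
by apply: ge_ereal_sup => _ [z' Az' <-]; rewrite lee_fin.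
Qed.

(** If [d] is a nearest point of [D] to [d + v], comparing with the distances
    to the other points of [D] bounds the inner products quadratically. *)
Lemma projection_regular_normal (W : euclidType R) (D : set W) (d v : W) :
  D d -> (forall d', D d' -> `|v| <= `|d + v - d'|) ->
  regular_normal_cone D d v.
Proof.
move=> Dd Hd; apply/regular_normalP; split=> // e e0; near=> d' => Dd'.
have d'e : `|d' - d| <= e.
  by rewrite distrC; near: d'; exact: cvgr_dist_le.
have : `|v| ^+ 2 <= `|v - (d' - d)| ^+ 2.
  rewrite ler_pXn2r ?nnegrE// opprB addrCA addrA; exact: Hd.
rewrite sqr_normD normrN innerNr => H.
have : `|d' - d| * `|d' - d| <= e * `|d' - d| by rewrite ler_wpM2r.
have : 0 <= e * `|d' - d| by rewrite mulr_ge0// ltW.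
move: H; rewrite (expr2 `|d' - d|); lra.
Unshelve. all: by end_near. Qed.

Lemma regular_normal_scale (V : euclidType R) (S : set V) (z v : V) (c : R) :
  0 <= c -> regular_normal_cone S z v -> regular_normal_cone S z (c *: v).
Proof.
rewrite le_eqVlt => /predU1P[<-|c0] /regular_normalP[Sz H];
  apply/regular_normalP; split=> // e e0.
  near=> z' => _; rewrite scale0r inner0l mulr_ge0//; exact: ltW.
apply: filterS (H _ (divr_gt0 e0 c0)) => z' Hz' /Hz'.
by rewrite innerZl -ler_pdivlMl// mulrA (mulrC c^-1).
Unshelve. all: by end_near. Qed.

(** Moving in one factor only stays in the product, so a normal to a product
    restricts to a normal to each factor. *)
Lemma regular_normal_prod (X Y : euclidType R) (A : set X) (B : set Y)
    (z v : eprod X Y) :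
  regular_normal_cone (A `*` B : set (eprod X Y)) z v ->
  regular_normal_cone A z.1 v.1 /\ regular_normal_cone B z.2 v.2.
Proof.
move: z v => [x y] [v1 v2] /regular_normalP[[/= Ax By] H].
split; apply/regular_normalP; split=> // e e0.
  have ic : (fun x' => (x', y) : eprod X Y) @ x --> ((x, y) : eprod X Y).
    by apply: cvg_eprod; [exact: cvg_id|exact: cvg_cst].
  have := ic _ (H e e0).
  apply: (@filterS _ (nbhs x)) => x' Hx' Ax'; move: (Hx' (conj Ax' By)).
  rewrite (_ : ((x', y) : eprod X Y) - (x, y) = (x' - x, 0)); last by congr pair; exact: subrr.
  by rewrite inner_eprod/= inner0r addr0 norm_eprod_fst.
have ic : (fun y' => (x, y') : eprod X Y) @ y --> ((x, y) : eprod X Y).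
  by apply: cvg_eprod; [exact: cvg_cst|exact: cvg_id].
have := ic _ (H e e0).
apply: (@filterS _ (nbhs y)) => y' Hy' By'; move: (Hy' (conj Ax By')).
rewrite (_ : ((x, y') : eprod X Y) - (x, y) = (0, y' - y)); last by congr pair; exact: subrr.
by rewrite inner_eprod/= inner0r add0r norm_eprod_snd.
Qed.

Lemma limiting_normal_dir_prod (X Y : euclidType R) (A : set X) (B : set Y)
    (z u v : eprod X Y) :
  limiting_normal_cone_dir (A `*` B : set (eprod X Y)) z u v ->
  limiting_normal_cone_dir A z.1 u.1 v.1 /\
  limiting_normal_cone_dir B z.2 u.2 v.2.
Proof.
move=> [t [u_ [v_ [t0 tc uc vc H]]]].
have cfst (w_ : (eprod X Y)^nat) (w : eprod X Y) : w_ @ \oo --> w ->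
    (fun k => (w_ k).1) @ \oo --> w.1.
  by move=> wc; apply: cvg_comp wc _; exact: fst_eprod_continuous.
have csnd (w_ : (eprod X Y)^nat) (w : eprod X Y) : w_ @ \oo --> w ->
    (fun k => (w_ k).2) @ \oo --> w.2.
  by move=> wc; apply: cvg_comp wc _; exact: snd_eprod_continuous.
split.
  exists t, (fun k => (u_ k).1), (fun k => (v_ k).1).
  split; [by []|by []|exact: cfst|exact: cfst|].
  by move=> k; have [] := regular_normal_prod (H k).
exists t, (fun k => (u_ k).2), (fun k => (v_ k).2).
split; [by []|by []|exact: csnd|exact: csnd|].
by move=> k; have [] := regular_normal_prod (H k).
Qed.

Lemma limiting_normal_dir_contingent (V : euclidType R) (S : set V)
    (z u v : V) :
  limiting_normal_cone_dir S z u v -> contingent_cone S z u.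
Proof.
by move=> [t [u_ [v_ [t0 tc uc vc H]]]]; exists t, u_; split=> // k; have [] := H k.
Qed.

(** Countable choice turns approximations of every accuracy into the three
    sequences of the definition. *)
Lemma limiting_normal_dir_approx (V : euclidType R) (S : set V) (z u v : V) :
  (forall e : R, 0 < e -> exists t u' v',
    [/\ 0 < t <= e, `|u' - u| <= e, `|v' - v| <= e
      & regular_normal_cone S (z + t *: u') v']) ->
  limiting_normal_cone_dir S z u v.
Proof.
move=> H.
have hcvg (W : normedModType R) (w_ : W^nat) (w : W) :
    (forall k, `|w_ k - w| <= harmonic k) -> w_ @ \oo --> w.
  move=> wk; apply/cvgrPdist_le => e e0; near=> k.
  rewrite distrC; apply: le_trans (wk k) _.
  have -> : harmonic k = `|0 - harmonic k| :> R.
    by rewrite sub0r normrN gtr0_norm// harmonic_gt0.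
  by near: k; apply: cvgr_dist_le => //; exact: cvg_harmonic.
have /choice[t] : forall k : nat, exists t u' v',
    [/\ 0 < t <= harmonic k, `|u' - u| <= harmonic k, `|v' - v| <= harmonic k
      & regular_normal_cone S (z + t *: u') v'].
  by move=> k; apply: H; exact: harmonic_gt0.
move=> /choice[u_] /choice[v_] K.
exists t, u_, v_; split.
- by move=> k; have [/andP[]] := K k.
- apply: hcvg => k; have [/andP[t0 tk] _ _ _] := K k.
  by rewrite subr0 gtr0_norm.
- by apply: hcvg => k; have [] := K k.
- by apply: hcvg => k; have [] := K k.
- by move=> k; have [] := K k.
Unshelve. all: by end_near. Qed.

End NormalCones.

(** * Calmness of a perturbed constraint system *)

Section Calmness.
Context (R : realType) (V W : euclidType R) (G : V -> W) (D : set W).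

(** The penalty [c * |z - z0|] makes the sublevel sets of the objective
    bounded, so the infimum over the closed feasible set is attained. *)
Lemma penalized_minimizer (c : R) (z0 : V) (p0 : W) :
  closed D -> continuous G -> 0 < c -> D (G z0 + p0) ->
  exists z p, [/\ D (G z + p), `|p| + c * `|z - z0| <= `|p0|
    & forall z' p', D (G z' + p') ->
        `|p| + c * `|z - z0| <= `|p'| + c * `|z' - z0|].
Proof.
move=> Dcl Gc c0 D0.
pose Phi (q : eprod V W) := `|q.2| + c * `|q.1 - z0|.
pose A := [set q : eprod V W | D (G q.1 + q.2)] `&` [set q | Phi q <= `|p0|].
have fstc := @fst_eprod_continuous R V W.
have sndc := @snd_eprod_continuous R V W.
have Phi_cont (T : topologicalType) (a : T -> V) (b : T -> W) :
    continuous a -> continuous b -> continuous (fun q => `|b q| + c * `|a q - z0|).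
  move=> ac bc q; apply: cvgD; first by apply: cvg_norm; exact: bc.
  by apply: cvgMl_tmp; apply: cvg_norm; apply: cvgB; [exact: ac|exact: cvg_cst].
have feas_cont (T : topologicalType) (a : T -> V) (b : T -> W) :
    continuous a -> continuous b -> continuous (fun q => G (a q) + b q).
  move=> ac bc q; apply: cvgD; last exact: bc.
  by apply: continuous_comp; [exact: ac|exact: Gc].
have Phic : continuous Phi by exact: Phi_cont.
have Acl : closed A.
  apply: closedI.
    apply: (@preimage_closed _ _ (fun q : eprod V W => G q.1 + q.2)) => // q _.
    exact: feas_cont.
  apply: (@preimage_closed _ _ Phi [set y | y <= `|p0|]) => [q _|].
    exact: Phic.
  exact: closed_le.
have Abd (q : eprod V W) : A q -> `|q| <= `|z0| + `|p0| / c + `|p0|.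
  move=> [_ /= Phiq]; apply: le_trans (norm_eprod_le _) _.
  have q2 : 0 <= `|q.2| by [].
  have q1 : `|q.1| <= `|q.1 - z0| + `|z0|.
    by rewrite -{1}(subrK z0 q.1) ler_normD.
  have cq : 0 <= c * `|q.1 - z0| by rewrite mulr_ge0// ltW.
  have : `|q.1 - z0| <= `|p0| / c.
    by rewrite ler_pdivlMr// mulrC; move: Phiq; rewrite /Phi; lra.
  by move: Phiq; rewrite /Phi; lra.
have A0 : A (z0, p0) by split=> //=; rewrite /Phi/= subrr normr0 mulr0 addr0.
have [||q qA qmin] := @compact_EVT_min _ R Phi A (ex_intro _ _ A0).
- exact: euclid_bounded_closed_compact Acl Abd.
- exact: continuous_subspaceT.
move: qA; rewrite inE => -[Dq Phiq].
exists q.1, q.2; split => // z' p' D'.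
have [Phi'|/ltW Phi'] := leP (Phi (z', p')) `|p0|.
  by apply: (qmin (z', p')); rewrite inE.
exact: le_trans Phiq Phi'.
Qed.

(** The hypothesis is read twice: with [z' = z] it says that [G z + p] is a
    nearest point of [D] to [G z]; with [G z' + p'] kept equal to [G z + p]
    it bounds from below the variation of the smooth function
    [z' |-> |G z + p - G z'|], whose gradient is [G'(z)^* v]. *)
Lemma penalized_minimizer_normal (c : R) (z : V) (p : W) :
  differentiable G z -> D (G z + p) -> p != 0 ->
  (forall z' p', D (G z' + p') -> `|p| - c * `|z' - z| <= `|p'|) ->
  let v := - (`|p|^-1 *: p) in
  regular_normal_cone D (G z + p) v /\
  forall h, `|inner v ('d G z h)| <= c * `|h|.
Proof.
move=> dG Dp p0 Hp v; have p_gt0 : 0 < `|p| by rewrite normr_gt0.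
split.
  rewrite /v -scalerN; apply: regular_normal_scale; first by rewrite invr_ge0.
  apply: projection_regular_normal => // d' Dd'.
  have := Hp z (d' - G z).
  by rewrite addrC subrK subrr normr0 mulr0 subr0 addrK normrN distrC; exact.
have key h : inner p ('d G z h) <= `|p| * (c * `|h|).
  set a := 'd G z h; apply/ler_addgt0Pr => e e0.
  pose K := `|p| * `|h| + `|a| ^+ 2 + 1.
  have K0 : 0 < K by rewrite ltr_wpDl// addr_ge0// ?mulr_ge0// sqr_ge0.
  pose d := e / K; have d0 : 0 < d by rewrite divr_gt0.
  have hc : (fun s : R => s *: h) @ (0 : R)^'+ --> (0 : V).
    rewrite -(scale0r h); apply: cvg_at_right_filter.
    by apply: (@cvgZr_tmp _ _ _ (nbhs (0 : R))); exact: cvg_id.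
  near (0 : R)^'+ => s.
  have s0 : 0 < s by near: s; exact: nbhs_right_gt.
  have sd : s <= d by near: s; exact: nbhs_right_le.
  have rem : `|G (z + s *: h) - G z - 'd G z (s *: h)| <= d * `|s *: h|.
    by near: s; exact: (hc _ (diff_remainder dG d0)).
  have := Hp (z + s *: h) (G z + p - G (z + s *: h)).
  rewrite (addrC (G (z + _))) subrK addrAC subrr add0r => /(_ Dp) low.
  have sa : 'd G z (s *: h) = s *: a by rewrite linearZ.
  rewrite sa in rem.
  have {low} low : `|p| - (c + d) * (s * `|h|) <= `|p - s *: a|.
    have : `|G z + p - G (z + s *: h)| <= `|p - s *: a| +
        `|G (z + s *: h) - G z - s *: a|.
      rewrite -(normrN (_ - _ - _)); apply: le_trans (ler_normD _ _).
      rewrite le_eqVlt; apply/orP; left; apply/eqP.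
      by rewrite opprB addrA subrK opprB addrA (addrC p).
    move: low rem; rewrite normrZ gtr0_norm//; lra.
  (* [a ^+ 2 >= 2 * |p| * a - |p| ^+ 2] keeps the lower bound valid after
     squaring whatever its sign. *)
  have sq : `|p| ^+ 2 - 2 * `|p| * ((c + d) * (s * `|h|)) <= `|p - s *: a| ^+ 2.
    have := sqr_ge0 (`|p - s *: a| - `|p|).
    have : `|p| * (`|p| - (c + d) * (s * `|h|)) <= `|p| * `|p - s *: a|.
      by rewrite ler_pM2l.
    by rewrite !expr2; lra.
  move: sq; rewrite sqr_normD innerNr innerZr normrN normrZ gtr0_norm// exprMn.
  move=> sq.
  have {}sq : s * (2 * inner p a) <=
      s * (2 * `|p| * (c + d) * `|h| + s * `|a| ^+ 2) by lra.
  rewrite ler_pM2l// in sq.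
  have sad : s * `|a| ^+ 2 <= d * `|a| ^+ 2 by rewrite ler_wpM2r// sqr_ge0.
  have da : 0 <= d * `|a| ^+ 2 by rewrite mulr_ge0 ?sqr_ge0// ltW.
  have dK : d * K = e by rewrite /d divfK// gt_eqF.
  by rewrite -dK /K; lra.
move=> h; rewrite /v innerNl innerZl normrN normrM ger0_norm ?invr_ge0//.
rewrite ler_pdivrMl// ler_norml key andbT lerNl -innerNr -linearN.
by rewrite -(normrN h) key.
Unshelve. all: by end_near. Qed.

(** Failure of calmness gives feasible pairs [(z0, p0)] with [z0] at distance
    more than [2 / e * |p0|] from the unperturbed solutions. Minimizing
    [|p| + e * |z - z0|] over the feasible pairs moves [z0] by at most
    [|p0| / e], half of that distance, so the minimizer [(z, p)] still has
    [p != 0], and [|p| <= |p0|] stays small compared with [|z - zb|]. *)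
Lemma not_calm_normals (zb : V) (e : R) :
  closed D -> (forall z, differentiable G z) -> D (G zb) ->
  ~ calm (fun p => [set z | D (G z + p)]) 0 zb -> 0 < e ->
  exists z p v, [/\ 0 < `|z - zb| <= e, `|p| <= e * `|z - zb|, `|v| = 1,
    regular_normal_cone D (G z + p) v
    & forall h, `|inner v ('d G z h)| <= e * `|h|].
Proof.
move=> Dcl dG Db ncalm e0.
have [p0 [z0 [D0 z0b far]]] : exists p0 z0, [/\ D (G z0 + p0),
    `|z0 - zb| <= e / 2 & forall a, D (G a) -> 2 / e * `|p0| < `|z0 - a|].
  apply: contrapT => H; apply: ncalm.
  exists (2 / e), 1, (e / 2); split; rewrite ?divr_gt0//.
  move=> p0 _ z0 [/= D0]; rewrite /closed_ball_/= distrC subr0 => z0b.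
  apply: contrapT => far; apply: H; exists p0, z0; split => // a Da.
  rewrite ltNge; apply/negP => az0; apply: far.
  exists a; first by rewrite /= addr0.
  have k0 : 0 <= 2 / e * `|p0| by rewrite mulr_ge0// divr_ge0// ltW.
  exists ((2 / e * `|p0|)^-1 *: (z0 - a)).
    rewrite /= sub0r normrN normrZ ger0_norm ?invr_ge0//.
    have [k_eq0|kN0] := eqVneq (2 / e * `|p0|) 0.
      by rewrite k_eq0 invr0 mul0r.
    by rewrite ler_pdivrMl ?mulr1// lt_neqAle eq_sym kN0.
  have [k_eq0|kN0] := eqVneq (2 / e * `|p0|) 0; last first.
    by rewrite scalerA divff// scale1r addrC subrK.
  move: az0; rewrite k_eq0 scale0r addr0 normr_le0 subr_eq0.
  by move=> /eqP ->.
have Gc : continuous G by move=> z; exact: differentiable_continuous.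
have [z [p [Dp le_p0 minp]]] := penalized_minimizer Dcl Gc e0 D0.
have ke : 2 / e * `|p0| = `|p0| / e + `|p0| / e by rewrite -mulrA; lra.
have zz0 : `|z - z0| <= `|p0| / e.
  by rewrite ler_pdivlMr// mulrC; apply: le_trans le_p0; rewrite lerDr.
have p0e : 0 <= `|p0| / e by rewrite divr_ge0// ltW.
have pN0 : p != 0.
  apply/eqP => p_0; move: Dp; rewrite p_0 addr0 => /far.
  by rewrite distrC ke; lra.
have minp_z z' p' : D (G z' + p') -> `|p| - e * `|z' - z| <= `|p'|.
  move=> D'; have := minp _ _ D'.
  have : e * `|z' - z0| <= e * `|z' - z| + e * `|z - z0|.
    by rewrite -mulrDr ler_pM2l//; exact: ler_distD.
  lra.
have [reg adj] := penalized_minimizer_normal (dG z) Dp pN0 minp_z.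
have z0zb := far _ Db.
have tri : `|z0 - zb| <= `|z - z0| + `|z - zb|.
  by rewrite (distrC z z0); exact: ler_distD.
have tri' : `|z - zb| <= `|z - z0| + `|z0 - zb|.
  exact: ler_distD.
exists z, p, (- (`|p|^-1 *: p)); split=> //.
- by apply/andP; split; lra.
- apply: (@le_trans _ _ `|p0|).
    by apply: le_trans le_p0; rewrite lerDl mulr_ge0// ltW.
  by rewrite mulrC -ler_pdivrMr//; lra.
- by rewrite normrN normrZ ger0_norm ?invr_ge0// mulVf// normr_eq0.
Qed.

(** This replaces the extraction of a convergent subsequence: as [e] shrinks,
    [harmonic k <= e] forces the index [k] to grow. *)
Lemma bounded_cluster_point (E : euclidType R) (q : E^nat) (M : R) :
  (forall k, `|q k| <= M) ->
  exists a, forall e : R, 0 < e -> exists2 k, harmonic k <= e & `|q k - a| <= e.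
Proof.
move=> qM.
have Kc : compact [set x : E | `|x| <= M].
  apply: (@euclid_bounded_closed_compact _ _ _ M) => //.
  apply: (@preimage_closed _ _ (fun x : E => `|x|) [set y | y <= M]) => [x _|].
    exact: norm_continuous.
  exact: closed_le.
have qK : (q @ \oo) [set x : E | `|x| <= M] by exists 0%N => // k _; exact: qM.
have [a [_ acl]] := Kc (q @ \oo) _ qK.
exists a => e e0.
have he : \forall k \near \oo, harmonic k <= e.
  near=> k; have -> : harmonic k = `|0 - harmonic k| :> R.
    by rewrite sub0r normrN gtr0_norm// harmonic_gt0.
  by near: k; apply: cvgr_dist_le => //; exact: cvg_harmonic.
have qe : (q @ \oo) (q @` [set k | harmonic k <= e]).
  by apply: (@filterS _ \oo _ [set k | harmonic k <= e]) he => k ke; exists k.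
have [_ [[k /= ke <-]]] := acl _ _ qe (nbhsx_ballx a e e0).
by rewrite -ball_normE/= distrC => /ltW qa; exists k.
Unshelve. all: by end_near. Qed.

(** The directions [(z - zb) / |z - zb|] and the unit normals [v] supplied by
    [not_calm_normals] have a common limit point; it is a direction together
    with a unit limiting normal in its image direction that is orthogonal to
    the range of the derivative. *)
Lemma calm_of_directional_normals (zb : V) :
  closed D -> continuously_differentiable G -> D (G zb) ->
  (forall w, w <> 0 -> forall v,
    limiting_normal_cone_dir D (G zb) ('d G zb w) v ->
    (forall h, inner v ('d G zb h) = 0) -> v = 0) ->
  calm (fun p => [set z | D (G z + p)]) 0 zb.
Proof.
move=> Dcl [dG cG] Db H; apply: contrapT => ncalm.
have : forall k : nat, exists z p v,
    [/\ 0 < `|z - zb| <= harmonic k, `|p| <= harmonic k * `|z - zb|, `|v| = 1,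
    regular_normal_cone D (G z + p) v
    & forall h, `|inner v ('d G z h)| <= harmonic k * `|h|].
  by move=> k; apply: not_calm_normals => //; exact: harmonic_gt0.
move=> /choice[z] /choice[p] /choice[v] K.
pose q k : eprod V W := (`|z k - zb|^-1 *: (z k - zb), v k).
have q1 k : `|(q k).1| = 1.
  have [/andP[zk _] _ _ _ _] := K k.
  by rewrite normrZ ger0_norm ?invr_ge0// mulVf// gt_eqF.
have q2 k : `|(q k).2| = 1 by have [] := K k.
have qM k : `|q k| <= 2.
  by apply: le_trans (norm_eprod_le _) _; rewrite q1 q2.
have [[w vb] cl] := bounded_cluster_point qM.
pose L := 'd G zb.
have [C C0 LC] := linear_lipschitz (diff_continuous (dG zb)).
have half0 : 0 < 1 / 2 :> R by rewrite divr_gt0.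
have w0 : w <> 0.
  move=> w0; have [k _ qk] := cl _ half0.
  have := le_trans (norm_fst_le _) qk.
  rewrite (_ : (q k - (w, vb)).1 = (q k).1 - w)// w0 subr0 q1; lra.
have vb0 : vb <> 0.
  move=> v0; have [k _ qk] := cl _ half0.
  have := le_trans (norm_snd_le _) qk.
  rewrite (_ : (q k - (w, vb)).2 = (q k).2 - vb)// v0 subr0 q2; lra.
apply/vb0/(H w w0).
  apply: limiting_normal_dir_approx => e e0.
  have e2 : 0 < e / 2 by rewrite divr_gt0.
  have /nbhs_norm0P[r r0 rem] := diff_remainder (dG zb) e2.
  near (0 : R)^'+ => d.
  have d0 : 0 < d by near: d; exact: nbhs_right_gt.
  have de : d <= e by near: d; exact: nbhs_right_le.
  have dr : d < r by near: d; exact: nbhs_right_lt.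
  have dC : d <= e / 2 / (C + 1).
    by near: d; apply: nbhs_right_le; rewrite divr_gt0// addr_gt0.
  have [k kd qk] := cl _ d0.
  have [/andP[t0 tk] pk _ regk _] := K k.
  have tN0 : `|z k - zb| != 0 by rewrite gt_eqF.
  exists `|z k - zb|, (`|z k - zb|^-1 *: (G (z k) + p k - G zb)), (v k); split.
  - by rewrite t0/=; exact/(le_trans tk)/(le_trans kd).
  - have wk : `|(q k).1 - w| <= d := le_trans (norm_fst_le _) qk.
    have := rem (z k - zb); rewrite /= (addrC zb) subrK.
    move=> /(_ (le_lt_trans (le_trans tk kd) dr)) remk.
    (* The error in the direction splits into the first order remainder, the
       perturbation [p k], and the error [(q k).1 - w] in the source. *)
    have -> : `|z k - zb|^-1 *: (G (z k) + p k - G zb) - 'd G zb w =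
        `|z k - zb|^-1 *: (G (z k) - G zb - 'd G zb (z k - zb) + p k)
        + 'd G zb ((q k).1 - w).
      have -> : 'd G zb ((q k).1 - w) =
          `|z k - zb|^-1 *: 'd G zb (z k - zb) - 'd G zb w.
        by rewrite linearB linearZ.
      rewrite addrA -scalerDr; congr (_ *: _ - _).
      by rewrite [RHS]addrAC subrK addrAC.
    apply: le_trans (ler_normD _ _) _.
    rewrite normrZ ger0_norm ?invr_ge0//.
    have : `|z k - zb|^-1 * `|G (z k) - G zb - 'd G zb (z k - zb) + p k|
        <= e / 2 + d.
      rewrite ler_pdivrMl//; apply: le_trans (ler_normD _ _) _.
      have : harmonic k * `|z k - zb| <= d * `|z k - zb| by rewrite ler_pM2r.
      lra.
    have : `|'d G zb ((q k).1 - w)| <= C * d.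
      by apply: le_trans (LC _) _; rewrite ler_pM2l.
    move: dC; rewrite ler_pdivlMr ?addr_gt0//; lra.
  - apply: le_trans (le_trans (norm_snd_le _) qk) de.
  - by rewrite scalerA divff// scale1r (addrC (G zb)) subrK.
move=> h; apply/eqP; rewrite -normr_le0; apply/ler_addgt0Pr => e e0.
rewrite add0r.
pose M := (C + 2) * `|h| + 1.
have M0 : 0 < M by rewrite ltr_wpDl// mulr_ge0// addr_ge0// ltW.
pose d := e / M; have d0 : 0 < d by rewrite divr_gt0.
have /nbhs_ballP[r /= r0 cGr] := cG zb _ d0.
near (0 : R)^'+ => s.
have s0 : 0 < s by near: s; exact: nbhs_right_gt.
have sd : s <= d by near: s; exact: nbhs_right_le.
have sr : s < r by near: s; exact: nbhs_right_lt.
have [k ks qk] := cl _ s0.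
have [/andP[t0 tk] _ v1 _ adjk] := K k.
have vk : `|v k - vb| <= s := le_trans (norm_snd_le _) qk.
have -> : inner vb ('d G zb h) = inner (v k) ('d G (z k) h)
    - inner (v k) ('d G (z k) h - 'd G zb h) - inner (v k - vb) ('d G zb h).
  by rewrite innerBr innerBl; ring.
have i1 : `|inner (v k) ('d G (z k) h)| <= d * `|h|.
  apply: le_trans (adjk h) _; rewrite ler_wpM2r//.
  exact: le_trans ks sd.
have i2 : `|inner (v k) ('d G (z k) h - 'd G zb h)| <= d * `|h|.
  apply: le_trans (norm_inner_le _ _) _; rewrite v1 mul1r; apply: cGr.
  rewrite -ball_normE/= distrC; apply: le_lt_trans sr.
  exact: le_trans tk ks.
have i3 : `|inner (v k - vb) ('d G zb h)| <= d * (C * `|h|).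
  apply: le_trans (norm_inner_le _ _) _.
  by apply: ler_pM => //; exact: le_trans vk sd.
apply: le_trans (ler_normB _ _) _.
apply: le_trans (lerD (ler_normB _ _) (lexx _)) _.
have dM : d * M = e by rewrite /d divfK// gt_eqF.
by rewrite -dM /M; lra.
Unshelve. all: by end_near. Qed.

End Calmness.

(** * Closedness of the graph of the normal cone mapping *)

Section Closedness.
Context (R : realType).

(** The polarization identity reduces continuity of [inner] to that of the
    norm. *)
Lemma inner_continuous (V : euclidType R) (T : topologicalType)
    (a b : T -> V) :
  continuous a -> continuous b -> continuous (fun t => inner (a t) (b t)).
Proof.
have E (u v : V) : inner u v =
    2^-1 * (`|u + v| * `|u + v| - `|u| * `|u| - `|v| * `|v|).
  by have := sqr_normD u v; rewrite !expr2; lra.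
move=> ac bc; under eq_fun do rewrite E.
move=> t.
apply: cvgMl_tmp; apply: cvgB; first apply: cvgB.
- by apply: cvgM; apply: cvg_norm; apply: cvgD;
     [exact: ac|exact: bc|exact: ac|exact: bc].
- by apply: cvgM; apply: cvg_norm; exact: ac.
- by apply: cvgM; apply: cvg_norm; exact: bc.
Qed.

Lemma closed_prod_eprod (X Y : euclidType R) (A : set X) (B : set Y) :
  closed A -> closed B -> closed (A `*` B : set (eprod X Y)).
Proof.
move=> Ac Bc; apply: closedI.
  by apply: preimage_closed Ac => z _; exact: fst_eprod_continuous.
by apply: preimage_closed Bc => z _; exact: snd_eprod_continuous.
Qed.

Lemma closed_gph_convex_normal_cone (V : euclidType R) (C : set V) :
  closed C -> closed (gph (convex_normal_cone C)).
Proof.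
move=> Ccl.
have -> : gph (convex_normal_cone C) = [set q : eprod V V | C q.1] `&`
    \bigcap_(z in C) [set q : eprod V V | inner q.2 (z - q.1) <= 0].
  by apply/seteqP; split=> q [Cq H]; split.
apply: closedI.
  by apply: preimage_closed Ccl => q _; exact: fst_eprod_continuous.
apply: closed_bigI => z _.
have c0 : closed [set y : R | y <= 0] by exact: closed_le.
apply: (@preimage_closed _ _ (fun q : eprod V V => inner q.2 (z - q.1))) c0 => q _.
have subz (T : topologicalType) (a : T -> V) :
    continuous a -> continuous (fun q => z - a q).
  by move=> ac t; apply: cvgB; [exact: cvg_cst|exact: ac].
apply: inner_continuous; first exact: snd_eprod_continuous.
by apply: subz; exact: fst_eprod_continuous.
Qed.

(** Each constraint [0 <= x^T A x] is linear in [A], hence continuous. *)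
Lemma closed_psd n : closed (psd R n).
Proof.
have -> : psd R n = \bigcap_(x in [set: 'cV[R]_n])
    [set A : Sym R n | 0 <= (x^T *m symval A *m x) 0 0].
  by apply/seteqP; split=> A H x => [_|]; exact: H.
apply: closed_bigI => x _.
have phi_lin : scalar (fun A : Sym R n => (x^T *m symval A *m x) 0 0).
  by move=> a A B; rewrite /= mulmxDr mulmxDl -scalemxAr -scalemxAl !mxE.
pose PL := GRing.isLinear.Build _ _ _ _ _ phi_lin.
pose phi : {scalar (Sym R n)} :=
  HB.pack (fun A : Sym R n => (x^T *m symval A *m x) 0 0) PL.
have [u uE] := riesz phi.
have -> : [set A : Sym R n | 0 <= (x^T *m symval A *m x) 0 0] =
    (fun A => inner u A) @^-1` [set y | 0 <= y].
  by apply/seteqP; split=> A /=; rewrite uE.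
apply: preimage_closed; last exact: closed_ge.
move=> A _; apply: inner_continuous; first exact: cst_continuous.
by move=> B; exact: cvg_id.
Qed.

End Closedness.

(** * Calmness of the complementarity system *)

Theorem theorem4p2 (R : realType) (n : nat) (X Y : euclidType R)
    (Omega_x : set X) (Omega_y : set Y) (f g : eprod X Y -> Sym R n)
    (xb : X) (yb : Y) :
  let zb : eprod X Y := (xb, yb) in
  closed Omega_x -> closed Omega_y ->
  continuously_differentiable f -> continuously_differentiable g ->
  Mtilde Omega_x Omega_y f g 0 zb ->
  (forall w : eprod X Y, w <> 0 ->
    contingent_cone Omega_x xb w.1 ->
    contingent_cone Omega_y yb w.2 ->
    contingent_cone (gphN_psd R n) (f zb, g zb)
      ('d f zb w, 'd g zb w) ->
    forall (d1 : X) (d2 : Y) (Lambda Delta : Sym R n),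
      limiting_normal_cone_dir Omega_x xb w.1 d1 ->
      d1 + gradient1 f xb yb Lambda + gradient1 g xb yb Delta = 0 ->
      limiting_normal_cone_dir Omega_y yb w.2 d2 ->
      d2 + gradient2 f xb yb Lambda + gradient2 g xb yb Delta = 0 ->
      limiting_normal_cone_dir (gphN_psd R n) (f zb, g zb)
        (partial1 f xb yb w.1 + partial2 f xb yb w.2,
         partial1 g xb yb w.1 + partial2 g xb yb w.2)
        (Lambda, Delta) ->
      [/\ d1 = 0, d2 = 0, Lambda = 0 & Delta = 0]) ->
  calm (Mtilde Omega_x Omega_y f g) 0 zb.
Proof.
move=> zb Oxcl Oycl Cf Cg Mzb H.
pose G (z : eprod X Y) : eprod (eprod X Y) (eprod (Sym R n) (Sym R n)) := (z, (f z, g z)).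
pose D : set (eprod (eprod X Y) (eprod (Sym R n) (Sym R n))) :=
  (Omega_x `*` Omega_y : set (eprod X Y)) `*` gphN_psd R n.
have dfz := Cf.1 zb; have dgz := Cg.1 zb.
have CG : continuously_differentiable G.
  apply: (continuously_differentiable_pair (f := idfun)).
    exact: continuously_differentiable_id.
  exact: continuously_differentiable_pair Cf Cg.
have dGE w : 'd G zb w = (w, ('d f zb w, 'd g zb w)).
  have [dfg dfgE] := diff_eprod dfz dgz.
  have [_ ->] := diff_eprod (f := idfun) (ex_diff (f := idfun)) dfg.
  by rewrite dfgE diff_val.
have Dcl : closed D.
  apply: closed_prod_eprod; first exact: closed_prod_eprod.
  exact/closed_gph_convex_normal_cone/closed_psd.
(* Regrouping the parameter [(((u, v), xi), eta)] as [((u, v), (xi, eta))] is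
   an isometry, by [pE] below. *)
have DE z (p : eprod (eprod (eprod X Y) (Sym R n)) (Sym R n)) :
    Mtilde Omega_x Omega_y f g p z <-> D (G z + (p.1.1, (p.1.2, p.2))).
  by case: p => [[[u v] xi] eta]; split=> [[]|[[]]].
have : calm (fun p => [set z | D (G z + p)]) 0 zb.
  apply: calm_of_directional_normals => //.
    by rewrite -(addr0 (G zb)); exact/(DE zb 0).
  move=> w w0 [[d1 d2] [Lam Del]] /[dup] Nv; rewrite dGE => + adj.
  move=> /limiting_normal_dir_prod[/= /limiting_normal_dir_prod[/= N1 N2] N3].
  have adjE (h : eprod X Y) : inner d1 h.1 + inner d2 h.2 +
      inner Lam ('d f zb h) + inner Del ('d g zb h) = 0.
    by have := adj h; rewrite dGE !inner_eprod/= addrA.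
  have [||||||-> -> -> ->] := H w w0 _ _ _ d1 d2 Lam Del N1 _ N2 _ _.
  - exact: limiting_normal_dir_contingent N1.
  - exact: limiting_normal_dir_contingent N2.
  - have C3 := limiting_normal_dir_contingent N3; exact C3.
  - apply: (gradient1_stationary dfz dgz) => h.
    by have := adjE (h, 0); rewrite /= inner0r addr0.
  - apply: (gradient2_stationary dfz dgz) => h.
    by have := adjE (0, h); rewrite /= inner0r add0r.
  - have uE : ('d f zb w, 'd g zb w) =
        (partial1 f xb yb w.1 + partial2 f xb yb w.2,
         partial1 g xb yb w.1 + partial2 g xb yb w.2) :> eprod _ _.
      by congr pair; exact/esym/partialsE.
    by move: N3; rewrite uE; exact.
  - by [].
move=> [kappa [eps [delta [k0 e0 d0 calmG]]]].
exists kappa, eps, delta; split=> // p pe z [/DE Dz zd].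
have pE : `|(p.1.1, (p.1.2, p.2)) - 0 : eprod (eprod X Y) (eprod (Sym R n) (Sym R n))| = `|p - 0|.
  rewrite !subr0; apply/eqP; rewrite -(@eqrXn2 _ 2)// !sqr_norm_eprod/=.
  by rewrite addrA.
have [|a Da [b b1 zE]] := calmG (p.1.1, (p.1.2, p.2)) _ z (conj Dz zd).
  by rewrite pE.
exists a; first exact/DE.
by exists b => //; rewrite -zE pE.
Qed.
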